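(* For a positive integer $n$, let $\mathcal{A}_n^+\subseteq\mathfrak{S}_n$ be the set of even permutations and $\mathcal{A}_n^-=\mathfrak{S}_n\setminus\mathcal{A}_n^+$ the set of odd permutations. For $\pi=\pi_1\pi_2\cdots\pi_n\in\mathfrak{S}_n$ let $\mathrm{exc}(\pi)=|\{i\in[n-1]:\pi_i>i\}|$. Define $$\mathrm{AE}_n^{+}(t)=\sum_{\pi\in\mathcal{A}_n^+}t^{\mathrm{exc}(\pi)},\qquad \mathrm{AE}_n^{-}(t)=\sum_{\pi\in\mathcal{A}_n^-}t^{\mathrm{exc}(\pi)}.$$ Then the distribution of the coefficients of $\mathrm{AE}_n^{+}(t)$, and likewise of $\mathrm{AE}_n^{-}(t)$, is asymptotically normal as $n\to\infty$. Moreover, for $n\ge 3$ these distributions have mean $(n-1)/2$, and for $n\ge 4$ they have variance $(n+1)/12$.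
   Context: To a polynomial $P(t)=\sum_k p_k t^k$ with nonnegative coefficients and $P(1)>0$ associate the random variable $X$ with $\Pr(X=k)=p_k/P(1)$. A sequence of such polynomials $P_n(t)=\sum_k p_{n,k}t^k$ has asymptotically normal coefficient distribution if, with $\mu_n$ and $\sigma_n^2$ the mean and variance of the associated random variable $X_n$, $\lim_{n\to\infty}\sup_{x\in\mathbb{R}}\left|\sum_{k\le\lfloor x\sigma_n+\mu_n\rfloor}\frac{p_{n,k}}{P_n(1)}-\Phi(x)\right|=0$, where $\Phi(x)=\frac{1}{\sqrt{2\pi}}\int_{-\infty}^x e^{-u^2/2}\,du$. The mean/variance of ''these numbers'' refers to the mean/variance of the associated random variable. *)

(* Defs.v *)
From HB Require Import structures.
From mathcomp Require Import all_boot all_order all_fingroup all_algebra.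
From mathcomp Require Import all_classical all_reals all_analysis.

Set Implicit Arguments.
Unset Strict Implicit.
Unset Printing Implicit Defensive.

Import Order.TTheory GRing.Theory Num.Theory.
Import numFieldNormedType.Exports.

Local Open Scope classical_set_scope.
Local Open Scope ring_scope.

Section CoefficientDistribution.
Variable R : realType.
Implicit Types P : {poly R}.

Definition has_coef_dist P : Prop := (forall k, 0 <= P`_k) /\ 0 < P.[1].

Definition coef_pmf P (k : nat) : R := P`_k / P.[1].

(* The support of X is contained in {0, ..., size P - 1}, so the sums below
   are E[X], E[(X - E[X])^2] and Pr(X <= floor y). *)
Definition coef_mean P : R := \sum_(k < size P) k%:R * coef_pmf P k.

Definition coef_variance P : R :=
  \sum_(k < size P) (k%:R - coef_mean P) ^+ 2 * coef_pmf P k.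

Definition coef_cdf P (y : R) : R :=
  \sum_(k < size P | (k%:Z <= Num.floor y)%R) coef_pmf P k.

Definition Phi (x : R) : R :=
  (Num.sqrt (2 * pi))^-1 *
  \int[lebesgue_measure]_(u in `]-oo, x]) expR (- (u ^+ 2) / 2).

(* The supremum is taken in the extended reals, where it always exists. The
   conditions making X_n well defined are only required for large n: a limit
   ignores finitely many terms, and there are no odd permutations of [1]. *)
Definition asymptotically_normal (P : nat -> {poly R}) : Prop :=
  (\forall n \near \oo, has_coef_dist (P n)) /\
  ereal_sup [set `|coef_cdf (P n)
                     (x * Num.sqrt (coef_variance (P n)) + coef_mean (P n))
                   - Phi x|%:E | x in [set: R]]
    @[n --> \oo] --> 0%E.

End CoefficientDistribution.

(* 'I_n is {0, ..., n-1}: positions and values are both shifted by one, and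
   the condition i.+1 < n says that the position lies in [n-1]. *)
Definition exc (n : nat) (s : 'S_n) : nat :=
  #|[set i : 'I_n | (i.+1 < n)%N && (i < s i)%N]%SET|.

Definition AE_even (R : realType) (n : nat) : {poly R} :=
  \sum_(s : 'S_n | ~~ odd_perm s) 'X^(exc s).

Definition AE_odd (R : realType) (n : nat) : {poly R} :=
  \sum_(s : 'S_n | odd_perm s) 'X^(exc s).

(* Main.v *)
Require Import Defs.
From HB Require Import structures.
From mathcomp Require Import all_boot all_order all_fingroup all_algebra.
From mathcomp Require Import all_classical all_reals all_analysis.
From mathcomp Require Import ring lra zify.

(**
Let [X_n] be the number of excedances of a uniform permutation of [n] letters.
Inserting the letter [n + 1] into the cycles shows that [X_n] is a Markov chain:
from [k] it stays put with probability [(k + 1) / (n + 1)] and otherwise moves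
to [k + 1]. Hence [Z_m = m (X_m - (m - 1) / 2)] is a martingale, with variance
[m^2 (m + 1) / 12]. The central limit theorem follows by Lindeberg's method
along this martingale, with test functions [Phi ((x - z) / sqrt s)]: these solve
the heat equation in closed form, so no Gaussian convolution is needed, and for
small [s] they approximate the indicator of [z <= x].

The same insertion shows that the signed sums [D_n f] of [f (exc s)] satisfy
[D_(n+1) f = D_n (f - f (. + 1))]. So [D_n] kills polynomials of degree less
than [n - 1] and is bounded by [2^n], which is negligible against [n!]: even and
odd permutations have the same first moments and the same limit law as all
permutations.
*)

Set Implicit Arguments.
Unset Strict Implicit.
Unset Printing Implicit Defensive.

Import Order.TTheory GRing.Theory Num.Theory.
Import numFieldNormedType.Exports.

Local Open Scope classical_set_scope.
Local Open Scope ring_scope.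

(** * The normal distribution function *)

Section Gaussian.
Variable R : realType.
Implicit Types (a b c r w x d : R).

Let mu := @lebesgue_measure R.

Let idTR : measurableTypeR R -> R := idfun.

#[local] HB.instance Definition _ :=
  @isMeasurableFun.Build _ _ _ _ idTR (@measurable_id _ _ setT).

Definition phi x : R := (Num.sqrt (2 * pi))^-1 * expR (- x ^+ 2 / 2).

Let phiE : phi = normal_pdf 0 1.
Proof.
apply/funext => x; rewrite normal_pdfE ?oner_eq0// /phi /normal_peak /normal_fun.
by rewrite subr0 expr1n mul1r mulr_natl.
Qed.

(** This bridge to the standard normal law yields the bounds, the monotonicity and the tails of
    [Phi] from facts about probability measures. *)
Lemma Phi_normal_prob x : (Phi x)%:E = normal_prob 0 1 `]-oo, x].
Proof.
rewrite /normal_prob -phiE.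
have ipdf : mu.-integrable `]-oo, x] (EFin \o phi).
  apply: (integrableS _ _ (subsetT _)) => //; rewrite phiE.
  exact: integrable_normal_pdf.
rewrite -[RHS]fineK ?integrable_fin_num//; congr EFin.
rewrite -[RHS]/(\int[mu]_(u in `]-oo, x]) phi u) /Phi.
have c0 : (Num.sqrt (2 * pi))^-1 != 0 :> R.
  by rewrite invr_eq0 gt_eqF// sqrtr_gt0 mulr_gt0// pi_gt0.
rewrite -RintegralZl//.
have -> : EFin \o (fun u => expR (- u ^+ 2 / 2)) =
     (fun u => (Num.sqrt (2 * pi))%:E * (EFin \o phi) u)%E.
  apply/funext => u/=; rewrite -EFinM mulrA divff ?mul1r//.
  by rewrite -invr_eq0.
exact: integrableZl.
Qed.

Lemma is_derive_Phi x : is_derive x (1 : R) (@Phi R) (phi x).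
Proof.
have -> : @Phi R = (fun x => \int[mu]_(u in `]-oo, x]) phi u).
  by apply/funext => y; rewrite phiE /Rintegral -/(normal_prob 0 1 _) -Phi_normal_prob.
have xu : x < x + 1 by rewrite ltrDl.
have ipdf : mu.-integrable `]-oo, (x + 1)%R] (EFin \o phi).
  apply: (integrableS _ _ (subsetT _)) => //; rewrite phiE.
  exact: integrable_normal_pdf.
have cx : {for x, continuous phi}.
  by rewrite phiE; apply: continuous_normal_pdf; exact: oner_neq0.
have [d1 d2] := continuous_FTC1 xu ipdf (ltNyr _) cx.
by apply: (DeriveDef d1); rewrite -derive1E d2.
Qed.

Let is_derive_phi x : is_derive x (1 : R) phi (- x * phi x).
Proof.
rewrite /phi; apply: is_derive_eq; rewrite /GRing.scale/= !mulr0 ?add0r ?addr0.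
by move: (_ ^-1) (expR _) => u v; field.
Qed.

Let phi_ge0 x : 0 <= phi x. 
Proof. by rewrite phiE normal_pdf_ge0. Qed.

(** The polynomial is [(1 + x ^+ 2 / 4) ^+ 2], hence at most [expR (x ^+ 2 / 4) ^+ 2]. All bounds
    below on [phi] times a power of [x] are read off from this one. *)
Let phi_decay x : phi x * (1 + x ^+ 2 / 2 + x ^+ 4 / 16) <= 1.
Proof.
have cle1 : (Num.sqrt (2 * pi))^-1 <= 1 :> R.
  rewrite invf_le1 ?sqrtr_gt0 ?mulr_gt0 ?pi_gt0//.
  rewrite -[leLHS]sqrtr1 ler_sqrt ?mulr_ge0 ?pi_ge0//.
  by have := pi_ge2 R; lra.
have e1 : 1 + x ^+ 2 / 2 + x ^+ 4 / 16 <= expR (x ^+ 2 / 2).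
  have -> : x ^+ 2 / 2 = x ^+ 2 / 4 + x ^+ 2 / 4 by field.
  have := expR_ge1Dx (x ^+ 2 / 4); rewrite expRD.
  have := sqr_ge0 x; have -> : x ^+ 4 = x ^+ 2 * x ^+ 2 by ring.
  set y := x ^+ 2; set z := expR _ => y0 h; nra.
rewrite /phi mulNr expRN -mulrA mulr_ile1 ?invr_ge0 ?sqrtr_ge0//.
  by rewrite mulr_ge0 ?invr_ge0 ?expR_ge0// !addr_ge0 ?divr_ge0 ?exprn_even_ge0.
by rewrite mulrC ler_pdivrMr ?mul1r ?expR_gt0.
Qed.

Let phi_le1 x : phi x <= 1.
Proof.
apply: le_trans (phi_decay x); rewrite ler_peMr// -addrA lerDl.
by rewrite addr_ge0// divr_ge0// exprn_even_ge0.
Qed.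

Lemma mul_phi_le1 x : `|x| * phi x <= 1.
Proof.
apply: le_trans (phi_decay x); rewrite mulrC ler_wpM2l//.
have -> : x ^+ 4 = `|x| ^+ 4 by rewrite -normrX ger0_norm// exprn_even_ge0.
have -> : x ^+ 2 = `|x| ^+ 2 by rewrite real_normK ?num_real.
have := sqr_ge0 (`|x| - 1); have := sqr_ge0 (`|x| ^+ 2).
by move: `|x| => y h1 h2; nra.
Qed.

Let cube_phi_le x : `|x| ^+ 3 * phi x <= 8.
Proof.
suff h : `|x| ^+ 3 <= 8 * (1 + x ^+ 2 / 2 + x ^+ 4 / 16).
  have := phi_decay x; have := phi_ge0 x.
  move: h; move: (1 + _ + _) (phi x) (`|x| ^+ 3) => u p q h p0 h1; nra.
have -> : x ^+ 4 = `|x| ^+ 4 by rewrite -normrX ger0_norm// exprn_even_ge0.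
have -> : x ^+ 2 = `|x| ^+ 2 by rewrite real_normK ?num_real.
have := sqr_ge0 (`|x| * (`|x| - 1)); have := sqr_ge0 `|x|.
by move: `|x| => y h1 h2; nra.
Qed.

Let is_derive_mulphi x :
  is_derive x (1 : R) (fun y => - y * phi y) ((x ^+ 2 - 1) * phi x).
Proof.
have h := is_derive_phi x.
by apply: is_derive_eq; rewrite /GRing.scale/=; ring.
Qed.

Let norm_d2phi_le x : `|(x ^+ 2 - 1) * phi x| <= 2.
Proof.
have := phi_decay x; have := phi_ge0 x.
have -> : x ^+ 4 = x ^+ 2 * x ^+ 2 by ring.
have := sqr_ge0 x; move: (x ^+ 2) (phi x) => y p y0 p0 h.
by rewrite ler_norml; apply/andP; split; nra.
Qed.

Let mvt (f df : R -> R) a b : (forall x, is_derive x (1 : R) f (df x)) ->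
  exists2 c, Num.min a b <= c <= Num.max a b & f b - f a = df c * (b - a).
Proof.
move=> fdf.
have cf : continuous f.
  by move=> x; apply/differentiable_continuous/derivable1_diffP; case: (fdf x).
have [ab|/ltW ab] := leP a b.
  have [c] := MVT_segment ab (fun x _ => fdf x) (continuous_subspaceT cf).
  by rewrite in_itv/= => cab e; exists c.
have [c] := MVT_segment ab (fun x _ => fdf x) (continuous_subspaceT cf).
by rewrite in_itv/= => cab e; exists c => //; rewrite -opprB e; ring.
Qed.

(** One integration of a derivative bound, without the gain of a factor [1 / (n + 1)]; iterating it
    produces Taylor remainders. *)
Let mvt_le (f df : R -> R) (K : R) (n : nat) :
  (forall x, is_derive x (1 : R) f (df x)) ->
  0 <= K -> (forall x, `|df x| <= K * `|x| ^+ n) ->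
  forall x, `|f x - f 0| <= K * `|x| ^+ n.+1.
Proof.
move=> fdf K0 dfK x; have [c c0x ->] := mvt 0 x fdf.
rewrite subr0 normrM exprSr mulrA ler_wpM2r//.
apply: le_trans (dfK c) _; rewrite ler_wpM2l// lerXn2r ?nnegrE//.
move: c0x; case: (leP 0 x) => x0 /andP[h1 h2];
  by case: (ler0P c) => c0; case: (ler0P x) => x1; lra.
Qed.

Lemma Phi_lipschitz x d : `|Phi (x + d) - Phi x| <= `|d|.
Proof.
have [c _ ->] := mvt x (x + d) is_derive_Phi.
have -> : x + d - x = d by ring.
by rewrite normrM ger0_norm// ler_piMl.
Qed.

Let is_derive_shift (f : R -> R) w x (df : R) :
  is_derive (w + x) (1 : R) f df -> is_derive x (1 : R) (fun y => f (w + y)) df.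
Proof.
move=> fdf; have h : is_derive x (1 : R) (fun y => w + y) 1.
  by apply: is_derive_eq; ring.
by have := is_derive1_comp fdf h; rewrite mulr1.
Qed.

Lemma Phi_taylor2 w d :
  `|Phi (w + d) - Phi w - d * phi w + d ^+ 2 / 2 * (w * phi w)| <= 2 * `|d| ^+ 3.
Proof.
(* Up to its value at 0, the function in [D1] is the derivative of the one in [D2], and that one is
   the derivative of the one in [D3]. So the bound 2 on the third derivative of [Phi] is integrated
   three times. *)
have D1 x : is_derive x (1 : R) (fun y => - (w + y) * phi (w + y))
     (((w + x) ^+ 2 - 1) * phi (w + x)).
  exact: (is_derive_shift (is_derive_mulphi (w + x))).
have D2 x : is_derive x (1 : R) (fun y => phi (w + y) + y * (w * phi w))
     (- (w + x) * phi (w + x) + w * phi w).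
  have h := is_derive_shift (is_derive_phi (w + x)).
  by apply: is_derive_eq; rewrite /GRing.scale/=; ring.
have D3 x : is_derive x (1 : R)
    (fun y => Phi (w + y) - y * phi w + y ^+ 2 / 2 * (w * phi w))
     (phi (w + x) - phi w + x * (w * phi w)).
  have h := is_derive_shift (is_derive_Phi (w + x)).
  by apply: is_derive_eq; rewrite /GRing.scale/=; field.
have B1 x : `|- (w + x) * phi (w + x) + w * phi w| <= 2 * `|x| ^+ 1.
  rewrite (_ : _ + _ = - (w + x) * phi (w + x) - (- (w + 0) * phi (w + 0))).
    by apply: (mvt_le (n := 0) D1 (ler0n _ 2)) => y; rewrite expr0 mulr1.
  by rewrite addr0; ring.
have B2 x : `|phi (w + x) - phi w + x * (w * phi w)| <= 2 * `|x| ^+ 2.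
  have := mvt_le D2 (ler0n _ 2) B1 x.
  by congr (`|_| <= _); rewrite addr0; ring.
have := mvt_le D3 (ler0n _ 2) B2 d.
by congr (`|_| <= _); rewrite addr0; field.
Qed.

(** With [r] at least 1/2, a point between [w] and [r * w] keeps the sign of [w] and at least half
    its size, so factors [w] can be absorbed by the decay of [phi] at that point. *)
Let between_scale w r c : 1/2 <= r ->
  Num.min w (r * w) <= c <= Num.max w (r * w) ->
  `|w| <= 2 * `|c| /\ `|c - w| <= `|r - 1| * `|w|.
Proof.
move=> r2; rewrite -normrM.
by case: (leP w (r * w)) => h /andP[h1 h2];
  case: (ger0P w) => w0; case: (ger0P c) => c0;
  case: (ger0P (c - w)) => cw; case: (ger0P ((r - 1) * w)) => rw;
  split; nra.
Qed.

Lemma Phi_scale_lipschitz w r : 1/2 <= r ->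
  `|Phi (r * w) - Phi w| <= 2 * `|r - 1|.
Proof.
move=> r2; have [c cw ->] := mvt w (r * w) is_derive_Phi.
have [w2 _] := between_scale r2 cw.
have -> : r * w - w = (r - 1) * w by ring.
rewrite normrM (ger0_norm (phi_ge0 c)) normrM.
have := mul_phi_le1 c; have := phi_ge0 c; have := normr_ge0 (r - 1).
move: (phi c) `|r - 1| => p q q0 p0 h.
have h2 : p * `|w| <= 2 by nra.
by rewrite mulrCA mulrC ler_wpM2r.
Qed.

(** Two mean value steps leave [(r - 1) * w * (c - w)] times the derivative of [phi] at some [v].
    Since [|w| <= 2 * |v|], this is at most [4 * (r - 1) ^+ 2 * |v| ^+ 3 * phi v], and [cube_phi_le]
    makes the constant 4 * 8, uniformly in [w]. *)
Lemma Phi_scale_taylor1 w r : 1/2 <= r ->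
  `|Phi (r * w) - Phi w - (r - 1) * (w * phi w)| <= 32 * (r - 1) ^+ 2.
Proof.
move=> r2; have [c cw ->] := mvt w (r * w) is_derive_Phi.
have [_ cwr] := between_scale r2 cw.
have [v vc vE] := mvt w c is_derive_phi.
have vw : Num.min w (r * w) <= v <= Num.max w (r * w).
  move: cw vc; case: (leP w (r * w)) => h /andP[h1 h2]; case: (leP w c) => h' /andP[h3 h4];
    by apply/andP; split; lra.
have [w2 _] := between_scale r2 vw.
have -> : phi c * (r * w - w) - (r - 1) * (w * phi w) =
  (r - 1) * w * (phi c - phi w) by ring.
rewrite vE; move: (phi v) (phi_ge0 v) (cube_phi_le v) => p p0 h.
rewrite !normrM normrN (ger0_norm p0).
have -> : (r - 1) ^+ 2 = `|r - 1| ^+ 2 by rewrite real_normK ?num_real.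
have := normr_ge0 (c - w); have := normr_ge0 w; have := normr_ge0 v.
have := normr_ge0 (r - 1); move: cwr w2.
move: `|c - w| `|w| `|v| `|r - 1| h => e u y q h.
move=> e1 u1 q0 y0 u0 e0.
have s1 : u * u <= 4 * (y * y) by nra.
have s2 : u * u * (y * p) <= 4 * (y * y) * (y * p).
  by rewrite ler_wpM2r// mulr_ge0.
have s3 : q * u * (y * p * e) <= q * u * (y * p * (q * u)).
  by rewrite !ler_wpM2l// !mulr_ge0.
have s4 : q * q * (u * u * (y * p)) <= q * q * 32.
  rewrite ler_wpM2l ?mulr_ge0//; apply: le_trans s2 _.
  by rewrite (_ : 4 * _ * _ = 4 * (y ^+ 3 * p)); [lra|ring].
apply: le_trans s3 _; rewrite expr2 [leRHS]mulrC; apply: le_trans s4.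
by rewrite le_eqVlt; apply/orP; left; apply/eqP; ring.
Qed.

Lemma Phi_ge0 x : 0 <= Phi x.
Proof. by rewrite -lee_fin Phi_normal_prob. Qed.

Lemma Phi_le1 x : Phi x <= 1.
Proof. by rewrite -lee_fin Phi_normal_prob probability_le1. Qed.

Lemma Phi_nondecreasing : {homo @Phi R : x y / x <= y}.
Proof.
move=> x y xy; rewrite -lee_fin !Phi_normal_prob le_measure ?inE//.
exact: subitvPr.
Qed.

Lemma Phi_tails (e : R) : 0 < e ->
  exists2 M, 0 < M & Phi (- M) <= e /\ 1 - Phi M <= e.
Proof.
move=> e0; pose X : {RV (normal_prob (0 : R) 1) >-> R} := idTR.
have cdfE : fine \o cdf X = @Phi R.
  by apply/funext => x /=; rewrite -[Phi x]/(fine (Phi x)%:E) Phi_normal_prob.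
have /fine_cvgP[_ c1] := cvg_cdfy1 X; rewrite cdfE in c1.
have /fine_cvgP[_ c0] := cvg_cdfNy0 X; rewrite cdfE in c0.
have [M1 [_ h1]] : \forall x \near +oo, `|1 - Phi x| < e.
  by move/cvgrPdist_lt : c1 => /(_ e e0).
have [M2 [_ h2]] : \forall x \near -oo, `|0 - Phi x| < e.
  by move/cvgrPdist_lt : c0 => /(_ e e0).
pose M := 1 + `|M1| + `|M2|.
exists M; first by rewrite /M -addrA ltr_pwDl// addr_ge0.
have := ler_norm M1; have := ler_norm (- M2).
rewrite normrN => n2 n1.
have := normr_ge0 M1; have := normr_ge0 M2 => n3 n4.
split.
  have /h2 : - M < M2 by rewrite /M; lra.
  by rewrite sub0r normrN ger0_norm ?Phi_ge0// => /ltW.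
have /h1 : M1 < M by rewrite /M; lra.
by rewrite ger0_norm ?subr_ge0 ?Phi_le1// => /ltW.
Qed.

End Gaussian.

(** * One step of the heat flow *)

Section Step.
Variable R : realType.

(** The scaling factor [r] is [1 - b / 2] up to [b ^+ 2]. The constant is 32 from
    [Phi_scale_taylor1] plus 1 from this approximation of [r]. *)
Lemma heat_time_step (w b : R) : 0 <= b <= 1 ->
  `|Phi (w / Num.sqrt (1 + b)) - Phi w + b / 2 * (w * phi w)| <= 33 * b ^+ 2.
Proof.
move=> /andP[b0 b1]; set r := (Num.sqrt (1 + b))^-1.
have s0 : 0 < Num.sqrt (1 + b) by rewrite sqrtr_gt0; lra.
have r0 : 0 < r by rewrite invr_gt0.
have rb : r ^+ 2 * (1 + b) = 1.
  by rewrite /r exprVn sqr_sqrtr ?mulVf//; lra.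
have u0 : 0 <= r ^+ 2 * b by rewrite mulr_ge0// sqr_ge0.
have v0 : 0 <= r ^+ 2 * (1 - b) by rewrite mulr_ge0 ?sqr_ge0// subr_ge0.
have r1 : r <= 1 by rewrite leNgt; apply/negP => h; nra.
have r2 : 1 / 2 <= r by rewrite leNgt; apply/negP => h; nra.
have rb1 : 1 - r <= b by nra.
have hb : `|(r - 1) + b / 2| <= b ^+ 2.
  set t := r - 1 + b / 2.
  (* A consequence of [r ^+ 2 * (1 + b) = 1]; it gives both [0 <= t] and [t <= b * (1 - r)]. *)
  have tE : (1 + r) * t = b * (1 - r) * (1 / 2 + r) by rewrite /t; nra.
  have br : 0 <= b * (1 - r) <= b ^+ 2.
    by rewrite expr2 mulr_ge0 ?ler_wpM2l// subr_ge0.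
  move: (b * (1 - r)) br tE => y /andP[y0 yb] tE.
  have t0 : 0 <= t by rewrite leNgt; apply/negP => h; nra.
  by rewrite ger0_norm//; apply: le_trans yb; rewrite leNgt; apply/negP => h; nra.
have hr : (r - 1) ^+ 2 <= b ^+ 2 by nra.
rewrite mulrC.
have := Phi_scale_taylor1 w r2; have := mul_phi_le1 w.
have pE : `|w * phi w| = `|w| * phi w.
  by rewrite normrM [X in _ * X]ger0_norm// /phi mulr_ge0 ?invr_ge0 ?sqrtr_ge0 ?expR_ge0.
rewrite -pE; move: (w * phi w) (Phi (r * w)) (Phi w) => p P1 P0 hp hP.
rewrite (_ : _ - _ + _ = (P1 - P0 - (r - 1) * p) + ((r - 1) + b / 2) * p); last by ring.
apply: le_trans (ler_normD _ _) _; rewrite normrM.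
have := normr_ge0 p; have := normr_ge0 (r - 1 + b / 2); nra.
Qed.

(** A centred two-point increment is traded for heat time [a]. The first-order terms cancel by
    centring, and the second-order ones by the heat equation when the variance of the increment is
    [a]. The discrepancy stays in the bound because the conditional variance of the chain depends on
    its state. *)
Lemma heat_step (c s a p q d e rho : R) :
  0 < s -> 0 <= a <= s -> 0 <= p -> 0 <= q -> p + q = 1 ->
  p * d + q * e = 0 -> `|d| <= rho -> `|e| <= rho ->
  `|p * Phi ((c - d) / Num.sqrt s) + q * Phi ((c - e) / Num.sqrt s)
    - Phi (c / Num.sqrt (s + a))| <=
  2 * (rho / Num.sqrt s) ^+ 3
  + `|p * d ^+ 2 + q * e ^+ 2 - a| / s + 33 * (a / s) ^+ 2.
Proof.
move=> s0 /andP[a0 as1] p0 q0 pq pdqe hd he.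
set h := Num.sqrt s; have h0 : 0 < h by rewrite sqrtr_gt0.
have h2 : h ^+ 2 = s by rewrite sqr_sqrtr// ltW.
set w := c / h; set b := a / s.
have b01 : 0 <= b <= 1.
  by rewrite divr_ge0 ?(ltW s0)//= ler_pdivrMr// mul1r.
have -> : c / Num.sqrt (s + a) = w / Num.sqrt (1 + b).
  have -> : s + a = s * (1 + b) by rewrite /b; field; rewrite gt_eqF.
  rewrite sqrtrM ?(ltW s0)// -/h invfM mulrA //.
have ht := heat_time_step w b01.
have -> : (c - d) / h = w + - (d / h) by rewrite /w; ring.
have -> : (c - e) / h = w + - (e / h) by rewrite /w; ring.
have := Phi_taylor2 w (- (d / h)); have := Phi_taylor2 w (- (e / h)).
rewrite !normrN !normf_div (ger0_norm (ltW h0)) !sqrrN.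
have bnd (x : R) : `|x| <= rho -> 2 * (`|x| / h) ^+ 3 <= 2 * (rho / h) ^+ 3.
  move=> hx; rewrite ler_pM2l// lerXn2r// ?nnegrE ?divr_ge0 ?(ltW h0)//.
    exact: le_trans hx.
  by rewrite ler_pM2r ?invr_gt0.
move=> /le_trans/(_ (bnd _ he)) te /le_trans/(_ (bnd _ hd)) td.
have pE : `|w * phi w| <= 1.
  apply: le_trans (mul_phi_le1 w).
  by rewrite normrM [X in _ * X]ger0_norm// /phi mulr_ge0 ?invr_ge0 ?sqrtr_ge0 ?expR_ge0.
move: (2 * _ ^+ 3) td te => K td te.
have K0 : 0 <= K by apply: le_trans td.
move: (33 * _) ht => T ht.
set Pd := Phi (w + - (d / h)) in td *; set Pe := Phi (w + - (e / h)) in te *.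
set m2 := p * d ^+ 2 + q * e ^+ 2.
set X := Pd - _ - _ + _ in td; set Y := Pe - _ - _ + _ in te.
set Z := _ + b / 2 * _ in ht.
(* [X] and [Y] are the two Taylor remainders in space and [Z] the one in time; only the variance
   discrepancy is left over. *)
have -> : p * Pd + q * Pe - Phi (w / Num.sqrt (1 + b)) =
    p * X + q * Y - Z - (m2 - a) / s * (w * phi w / 2).
  have q1 : q = 1 - p by rewrite -pq; ring.
  have e1 : q * (- (e / h) * phi w) = p * (d / h * phi w).
    rewrite (_ : q * _ = - (q * e) / h * phi w); last by ring.
    by rewrite (_ : - (q * e) = p * d); [ring|rewrite -[RHS]subr0 -pdqe; ring].
  rewrite /X /Y /Z /m2 /b -h2.
  apply/eqP; rewrite -subr_eq0; apply/eqP.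
  rewrite (_ : _ - _ =
     (q * (- (e / h) * phi w) - p * (d / h * phi w))
     + (p + q - 1) * Phi w); last by field; rewrite gt_eqF.
  by rewrite e1 pq; ring.
have n3 : `|(m2 - a) / s * (w * phi w / 2)| <= `|m2 - a| / s.
  rewrite normrM normf_div (gtr0_norm s0) ler_piMr ?divr_ge0 ?(ltW s0)//.
  rewrite normf_div (ger0_norm (ler0n R 2)); lra.
have n1 : `|p * X + q * Y| <= K.
  apply: le_trans (ler_normD _ _) _.
  rewrite !normrM (ger0_norm p0) (ger0_norm q0).
  rewrite -[leRHS]mul1r -pq mulrDl lerD// ler_wpM2l//.
apply: le_trans (ler_normB _ _) _.
rewrite [leRHS]addrAC lerD//.
apply: le_trans (ler_normB _ _) _.
by rewrite lerD.
Qed.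
End Step.

(** * Excedances under cycle insertion *)

Section Insertion.

Lemma excE n (s : 'S_n) : exc s = (\sum_(i < n) (i < s i))%N.
Proof.
rewrite /exc cardsE -sum1_card big_mkcond; apply: eq_bigr => i _.
rewrite unfold_in /=; case: (ltnP i (s i)) => h; last by rewrite andbF.
by rewrite (leq_ltn_trans h).
Qed.

Lemma exc_leq n (s : 'S_n.+1) : (exc s <= n)%N.
Proof.
rewrite excE big_ord_recr/= [X in (_ + X)%N](_ : _ = 0)%N; last first.
  by rewrite ltnNge -ltnS ltn_ord.
rewrite addn0 (@leq_trans (\sum_(i < n) 1)%N)//; last by rewrite sum_nat_const card_ord muln1.
by apply: leq_sum => i _; exact: leq_b1.
Qed.

(** The left factor acts first: [x.2] is sent to the new maximum, and the maximum to the former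
    image of [x.2]. For [x.2 = ord_max] the maximum becomes a fixed point. *)
Definition insert_perm n (x : 'S_n * 'I_n.+1) : 'S_n.+1 :=
  (tperm x.2 ord_max * lift_perm ord_max ord_max x.1)%g.

(** The position [i] is recovered as the preimage of the maximum; the transposition can then be
    cancelled. *)
Lemma insert_perm_inj n : injective (@insert_perm n).
Proof.
move=> [s i] [t j] /= e.
have ij : i = j.
  have : insert_perm (s, i) i = insert_perm (t, j) i by rewrite e.
  rewrite !permM tpermL lift_perm_id.
  by rewrite -{1}(lift_perm_id ord_max ord_max t) => /perm_inj;
     rewrite -{1}(tpermL j ord_max) => /perm_inj.
rewrite -ij in e *; move/mulgI : e => e; congr (_, _).
apply/permP => k; apply: (@lift_inj _ ord_max).
by rewrite -!(lift_perm_lift ord_max ord_max) e.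
Qed.

Lemma insert_perm_bij n : bijective (@insert_perm n).
Proof.
apply: inj_card_bij; first exact: insert_perm_inj.
by rewrite card_prod card_ord !card_Sn factS mulnC.
Qed.

Lemma odd_insert_perm n (s : 'S_n) i :
  odd_perm (insert_perm (s, i)) = (i != ord_max) (+) odd_perm s.
Proof. by rewrite odd_mul_tperm odd_lift_perm addbb. Qed.

Let lift_max n (i : 'I_n) : lift ord_max i = i :> nat.
Proof. by rewrite /= /bump leqNgt ltn_ord. Qed.

Let widen_lift n (i : 'I_n) : widen_ord (leqnSn n) i = lift ord_max i.
Proof. by apply/esym/val_inj; exact: lift_max. Qed.

Lemma exc_insert_max n (s : 'S_n) : exc (insert_perm (s, ord_max)) = exc s.
Proof.
rewrite !excE big_ord_recr/= {2}/insert_perm/= tperm1 mul1g lift_perm_id ltnn addn0.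
apply: eq_bigr => i _.
by rewrite widen_lift /insert_perm/= tperm1 mul1g lift_perm_lift !lift_max.
Qed.

(* Inserting the new maximum right after [i] in its cycle of [s] destroys the
   excedance of [s] at [i], if there is one, and always creates one there. *)
Lemma exc_insert_lift n (s : 'S_n) (i : 'I_n) :
  exc (insert_perm (s, lift ord_max i)) = (exc s + ~~ (i < s i))%N.
Proof.
rewrite !excE big_ord_recr/= [X in (_ + X)%N](_ : _ = 0)%N ?addn0; last first.
  by rewrite ltnNge -ltnS ltn_ord.
rewrite (bigD1 i)//= [in RHS](bigD1 i)//=.
rewrite widen_lift {1}/insert_perm/= permM tpermL lift_perm_id/= ltn_ord.
rewrite addnAC [X in _ = (X + _)%N]addnC addn_negb; congr addn; apply: eq_bigr => j ji.
rewrite widen_lift /insert_perm/= permM tpermD ?lift_perm_lift ?lift_max//.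
  by rewrite (inj_eq lift_inj) eq_sym.
by rewrite neq_lift.
Qed.

Variable R : realType.
Implicit Types (f : nat -> R) (n : nat).

(** The weight of the parity lets one recurrence serve both the plain sums and the signed ones. *)
Definition exc_sum (w : bool -> R) n f := \sum_(s : 'S_n) w (odd_perm s) * f (exc s).

(** Insertion as a fixed point keeps parity and excedances. The other [n] insertions flip the
    parity: [exc s] of them keep the number of excedances, and the remaining ones raise it by
    one. *)
Lemma exc_sum_rec (w : bool -> R) n f :
  exc_sum w n.+1 f = \sum_(s : 'S_n) (w (odd_perm s) * f (exc s) +
    w (~~ odd_perm s) * ((exc s)%:R * f (exc s) + (n%:R - (exc s)%:R) * f (exc s).+1)).
Proof.
rewrite /exc_sum (reindex (@insert_perm n)) /=; last first.
  exact: onW_bij (insert_perm_bij n).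
rewrite -(pair_bigA _ (fun s i => w (odd_perm (insert_perm (s, i))) *
     f (exc (insert_perm (s, i)))))/=; apply: eq_bigr => s _.
rewrite big_ord_recr/= addrC odd_insert_perm eqxx exc_insert_max; congr (_ + _).
under eq_bigr => i _.
  rewrite widen_lift odd_insert_perm eq_sym neq_lift exc_insert_lift.
  rewrite (_ : f _ = (i < s i)%:R * f (exc s) + (1 - (i < s i)%:R) * f (exc s).+1).
  over.
  by case: ltnP => _ /=; rewrite ?addn0 ?addn1; ring.
rewrite -mulr_sumr big_split/= -!mulr_suml sumrB -natr_sum -excE.
by rewrite sumr_const card_ord.
Qed.

Definition exc_tot := exc_sum (fun=> 1).
(** The signed sum [D_n] of the header. *)
Definition exc_alt := exc_sum (fun b => (-1) ^+ b).

Lemma exc_tot_rec n f : exc_tot n.+1 f =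
  exc_tot n (fun k => (k%:R + 1) * f k + (n%:R - k%:R) * f k.+1).
Proof.
rewrite /exc_tot exc_sum_rec; apply: eq_bigr => s _.
by ring.
Qed.

Let exc_alt_rec n f : exc_alt n.+1 f =
  exc_alt n (fun k => (1 - k%:R) * f k - (n%:R - k%:R) * f k.+1).
Proof.
rewrite /exc_alt exc_sum_rec; apply: eq_bigr => s _.
by case: odd_perm => /=; ring.
Qed.

Lemma exc_tot1 f : exc_tot 1 f = f 0%N.
Proof.
rewrite /exc_tot /exc_sum (big_pred1 1%g) => [|s]; last first.
  by apply/esym/eqP/permP => i; rewrite !ord1.
by rewrite mul1r; have := exc_leq (1 : 'S_1)%g; rewrite leqn0 => /eqP ->.
Qed.

Let exc_alt1 f : exc_alt 1 f = f 0%N.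
Proof.
rewrite /exc_alt /exc_sum (big_pred1 1%g) => [|s]; last first.
  by apply/esym/eqP/permP => i; rewrite !ord1.
by rewrite odd_perm1 mul1r; have := exc_leq (1 : 'S_1)%g; rewrite leqn0 => /eqP ->.
Qed.

(* Equivalently, the signed excedance polynomial on [n] letters is
   [(1 - t) ^ (n - 1)]. *)
Lemma exc_alt_diff n f : exc_alt n.+2 f = exc_alt n.+1 (fun k => f k - f k.+1).
Proof.
elim: n f => [|n IHn] f; first by rewrite exc_alt_rec !exc_alt1; ring.
(* The difference operator intertwines the recurrence operators: applied after the one for [n.+2] it
   equals the one for [n.+1] applied to differences. *)
rewrite exc_alt_rec IHn [RHS]exc_alt_rec; apply: eq_bigr => s _; congr (_ * _).
by rewrite -!natr1; ring.
Qed.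

(** Each passage to differences at most doubles the uniform bound. *)
Lemma exc_alt_le n f (K : R) : (forall k, `|f k| <= K) ->
  `|exc_alt n.+1 f| <= 2 ^+ n * K.
Proof.
elim: n f K => [|n IHn] f K fK; first by rewrite exc_alt1 expr0 mul1r.
rewrite exc_alt_diff exprSr -mulrA; apply: IHn => k.
by rewrite mulr_natl mulr2n (le_trans (ler_normB _ _))// lerD.
Qed.

(** Three differences annihilate a quadratic, whence the threshold of four letters for the
    variance. *)
Lemma exc_alt_quad n (a b c : R) :
  exc_alt n.+4 (fun k => a * k%:R ^+ 2 + b * k%:R + c) = 0.
Proof.
rewrite !exc_alt_diff [LHS](_ : _ = exc_alt n.+1 (fun=> 0)).
  by rewrite /exc_alt /exc_sum big1// => s _; rewrite mulr0.
by apply: eq_bigr => s _; congr (_ * _); rewrite -!natr1; ring.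
Qed.

(** Two differences suffice here, whence the threshold of three letters for the mean. *)
Lemma exc_alt_lin n (a b : R) :
  exc_alt n.+3 (fun k => a * k%:R + b) = 0.
Proof.
rewrite !exc_alt_diff [LHS](_ : _ = exc_alt n.+1 (fun=> 0)).
  by rewrite /exc_alt /exc_sum big1// => s _; rewrite mulr0.
by apply: eq_bigr => s _; congr (_ * _); rewrite -!natr1; ring.
Qed.

End Insertion.

(** * The central limit theorem for excedances *)

Local Ltac nonzero := rewrite ?gt_eqF //=; lra.

(** * Mean and variance of the number of excedances *)

Section ExcMean.
Variable R : realType.
Implicit Types (f g : nat -> R) (m n : nat).

Definition exc_mean n f : R := exc_tot n f / n`!%:R.

Let fact_neq0 n : n`!%:R != 0 :> R.
Proof. by rewrite pnatr_eq0 -lt0n fact_gt0. Qed.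

Lemma exc_mean_rec n f : exc_mean n.+1 f = exc_mean n (fun k =>
  (k%:R + 1) / n.+1%:R * f k + (n%:R - k%:R) / n.+1%:R * f k.+1).
Proof.
rewrite /exc_mean exc_tot_rec factS natrM invfM mulrA; congr (_ / _).
rewrite /exc_tot /exc_sum mulr_suml; apply: eq_bigr => s _.
by have n0 := ler0n R n; field; nonzero.
Qed.

Lemma exc_meanD n f g :
  exc_mean n (fun k => f k + g k) = exc_mean n f + exc_mean n g.
Proof.
rewrite /exc_mean -mulrDl; congr (_ / _).
by rewrite -big_split; apply: eq_bigr => s _; rewrite mulrDr.
Qed.

Lemma exc_meanZ n (a : R) f : exc_mean n (fun k => a * f k) = a * exc_mean n f.
Proof.
rewrite /exc_mean mulrA; congr (_ / _).
by rewrite [RHS]mulr_sumr; apply: eq_bigr => s _; rewrite mulrCA.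
Qed.

Lemma exc_mean_cst n (c : R) : exc_mean n (fun=> c) = c.
Proof.
rewrite /exc_mean /exc_tot /exc_sum sumr_const mul1r.
have -> : #|'S_n| = n`! by rewrite -card_Sn.
by rewrite -[c *+ _]mulr_natr mulfK.
Qed.

Lemma eq_exc_mean n f g : (forall k, f k = g k) -> exc_mean n f = exc_mean n g.
Proof.
by move=> fg; rewrite /exc_mean; congr (_ / _); apply: eq_bigr => s _; rewrite fg.
Qed.

Lemma exc_mean_le n f g : (forall k, (k <= n)%N -> f k <= g k) ->
  exc_mean n.+1 f <= exc_mean n.+1 g.
Proof.
move=> fg; rewrite /exc_mean ler_wpM2r ?invr_ge0//.
by apply: ler_sum => s _; rewrite !mul1r fg// exc_leq.
Qed.

Lemma exc_mean_norm n f g h : (forall k, (k <= n)%N -> `|f k - g k| <= h k) ->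
  `|exc_mean n.+1 f - exc_mean n.+1 g| <= exc_mean n.+1 h.
Proof.
move=> fg.
have h1 : exc_mean n.+1 f <= exc_mean n.+1 (fun k => g k + h k).
  by apply: exc_mean_le => k /fg; rewrite ler_norml; lra.
have h2 : exc_mean n.+1 g <= exc_mean n.+1 (fun k => f k + h k).
  by apply: exc_mean_le => k /fg; rewrite ler_norml; lra.
by move: h1 h2; rewrite !exc_meanD ler_norml; lra.
Qed.

(** One more letter multiplies the centred mean by [(n + 1) / (n + 2)]: this is the martingale
    property of the header. *)
Lemma exc_mean_id n : exc_mean n.+1 (fun k => k%:R - n%:R / 2) = 0.
Proof.
elim: n => [|n IHn].
  by rewrite /exc_mean exc_tot1 mul0r subrr mul0r.
rewrite exc_mean_rec -[RHS](mulr0 ((n%:R + 1) / (n%:R + 2))) -IHn -exc_meanZ.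
by apply: eq_exc_mean => k; rewrite -!natr1; have n0 := ler0n R n; field; nonzero.
Qed.

Lemma exc_mean_sqr n :
  exc_mean n.+2 (fun k => (k%:R - n.+1%:R / 2) ^+ 2) = n.+3%:R / 12.
Proof.
(* For [m = 0] the factor [m%:R] erases the one-letter variance, which is 0 and does not follow the
   formula; the induction therefore starts at two letters. *)
have rec m : exc_mean m.+2 (fun k => (k%:R - m.+1%:R / 2) ^+ 2) =
  m%:R / m.+2%:R * exc_mean m.+1 (fun k => (k%:R - m%:R / 2) ^+ 2) + 1 / 4.
  rewrite exc_mean_rec -exc_meanZ -[1/4 in RHS](exc_mean_cst m.+1) -exc_meanD.
  by apply: eq_exc_mean => k; rewrite -!natr1; have m0 := ler0n R m; field; nonzero.
elim: n => [|n IHn]; first by rewrite rec; field.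
by rewrite rec IHn -!natr1; have n0 := ler0n R n; field; nonzero.
Qed.

Lemma exc_mean_sqr_le n :
  exc_mean n.+1 (fun k => (k%:R - n%:R / 2) ^+ 2) <= n.+2%:R / 12.
Proof.
case: n => [|n]; last by rewrite exc_mean_sqr.
by rewrite /exc_mean exc_tot1 mul0r subrr expr0n mul0r divr_ge0.
Qed.

End ExcMean.

(** * Lindeberg's method on [N.+1] letters, with smoothing width [eps] *)

Section Lindeberg.
Variables (R : realType) (N : nat) (eps : R) (x : R).
Let sigma : R := Num.sqrt (N.+2%:R / 12).
Hypothesis eps0 : 0 < eps.
Hypothesis eps1 : eps <= 1.
Hypothesis sigma_eps : sigma^-1 <= eps.

Let sigma2 : sigma ^+ 2 = N.+2%:R / 12.
Proof. by rewrite sqr_sqrtr// divr_ge0. Qed.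

Let sigma0 : 0 < sigma.
Proof. by rewrite sqrtr_gt0 divr_gt0. Qed.

Let rV : R := N.+1%:R * sigma.
Let rV0 : 0 < rV. Proof. by rewrite mulr_gt0. Qed.
Let rV2 : rV ^+ 2 = N.+1%:R ^+ 2 * N.+2%:R / 12.
Proof. by rewrite exprMn sigma2 mulrA. Qed.

(* [z m] is the martingale of the header on [m.+1] letters, normalised by its
   final standard deviation [rV]; [v m] is its variance before normalisation,
   except for [m = 0], where the true variance is 0. *)
Let z m k : R := m.+1%:R * (k%:R - m%:R / 2) / rV.
Let v m : R := m.+1%:R ^+ 2 * m.+2%:R / 12.
(** The heat time left after [m] steps: [eps ^+ 2] at [m = N], and close to [1 + eps ^+ 2] at the
    start. *)
Let s m : R := eps ^+ 2 + 1 - v m / rV ^+ 2.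
Let test m k : R := Phi ((x - z m k) / Num.sqrt (s m)).

(** The three terms of [heat_step], with increments bounded by [sigma^-1], remaining time at least
    [eps ^+ 2], and the variance discrepancy replaced by a bound on its mean. *)
Let err : R := 2 * (sigma^-1 / eps) ^+ 3 + 2 / (N.+1%:R ^+ 2 * eps ^+ 2)
  + 33 * (sigma^-1 ^+ 2 / eps ^+ 2) ^+ 2.

Let s_ge m : (m <= N)%N -> eps ^+ 2 <= s m.
Proof.
move=> mN; rewrite /s -addrA lerDl subr_ge0 ler_pdivrMr ?exprn_gt0// mul1r.
rewrite rV2 /v ler_pM2r ?invr_gt0// ler_pM ?exprn_ge0 ?ler0n//.
  by rewrite lerXn2r ?nnegrE ?ler0n// ler_nat.
by rewrite ler_nat.
Qed.

Let lindeberg_step m : (m < N)%N ->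
  `|exc_mean m.+2 (test m.+1) - exc_mean m.+1 (test m)| <= err.
Proof.
move=> mN; have mN' : m.+2%:R <= N.+1%:R :> R by rewrite ler_nat.
have m0 := ler0n R m; have N0 := ler0n R N.
have mm : m.+2%:R = m%:R + 2 :> R by rewrite -[m.+2]addn2 natrD.
have mm1 : m.+1%:R = m%:R + 1 :> R by rewrite natr1.
have NN : N.+2%:R = N.+1%:R + 1 :> R by rewrite natr1.
(* The normalised variance increment [(v m.+1 - v m) / rV ^+ 2]. *)
pose a : R := m.+2%:R * (3 * m%:R + 5) / 12 / rV ^+ 2.
have sE : s m = s m.+1 + a.
  by rewrite /s /a /v -!natr1; field; nonzero.
have s1 := s_ge mN.
have e20 : 0 < eps ^+ 2 by rewrite exprn_gt0.
have s0 : 0 < s m.+1 by apply: lt_le_trans s1.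
have rho2 : sigma^-1 ^+ 2 = N.+1%:R ^+ 2 / rV ^+ 2.
  by rewrite /rV; field; nonzero.
have a_rho : 0 <= a <= sigma^-1 ^+ 2.
  rewrite rho2 /a; apply/andP; split.
    by rewrite divr_ge0 ?sqr_ge0// divr_ge0// mulr_ge0//; lra.
  rewrite ler_pM2r ?invr_gt0 ?exprn_gt0//.
  have h1 : m.+2%:R ^+ 2 <= N.+1%:R ^+ 2 :> R by rewrite lerXn2r ?nnegrE ?ler0n.
  by apply: le_trans h1; rewrite mm; nra.
have rho_eps : sigma^-1 ^+ 2 <= eps ^+ 2.
  by rewrite lerXn2r ?nnegrE ?invr_ge0 ?(ltW sigma0) ?(ltW eps0).
rewrite exc_mean_rec.
pose h (k : nat) : R := (2 * (sigma^-1 / eps) ^+ 3 + 33 * (sigma^-1 ^+ 2 / eps ^+ 2) ^+ 2)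
   + (m.+2%:R / 12 + (k%:R - m%:R / 2) ^+ 2) / rV ^+ 2 / eps ^+ 2.
apply: (@le_trans _ _ (exc_mean m.+1 h)); last first.
  rewrite /h exc_meanD exc_mean_cst.
  under eq_exc_mean do rewrite -mulrA mulrC.
  rewrite exc_meanZ exc_meanD exc_mean_cst.
  rewrite /err -[leRHS]addrA [X in _ <= _ + X]addrC addrA lerD2l.
  have := exc_mean_sqr_le R m; set E := exc_mean _ _ => hE.
  (* Both parts of the discrepancy have mean at most [m.+2%:R / 12], which is at most
     [sigma ^+ 2]. *)
  apply: (@le_trans _ _ ((rV ^+ 2)^-1 / eps ^+ 2 * (2 * sigma ^+ 2))).
    rewrite ler_wpM2l ?divr_ge0 ?invr_ge0 ?sqr_ge0//.
    by rewrite sigma2; lra.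
  rewrite le_eqVlt; apply/orP; left; apply/eqP; rewrite /rV.
  by field; nonzero.
apply: exc_mean_norm => k km.
have km' : k%:R <= m%:R :> R by rewrite ler_nat.
have k0 : 0 <= k%:R :> R by [].
pose d := z m.+1 k - z m k; pose e := z m.+1 k.+1 - z m k.
pose p : R := (k%:R + 1) / m.+2%:R; pose q : R := (m.+1%:R - k%:R) / m.+2%:R.
have dE : d = (k%:R - m%:R / 2 - m.+2%:R / 2) / rV.
  by rewrite /d /z -!natr1; field; nonzero.
have eE : e = (k%:R - m%:R / 2 + m.+2%:R / 2) / rV.
  by rewrite /e /z -!natr1; field; nonzero.
have p0 : 0 <= p by rewrite divr_ge0//; lra.
have q0 : 0 <= q by rewrite divr_ge0//; lra.
have pq1 : p + q = 1 by rewrite /p /q -!natr1; field; nonzero.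
have pdqe : p * d + q * e = 0.
  by rewrite dE eE /p /q -!natr1; field; nonzero.
have rhoE : sigma^-1 = N.+1%:R / rV by rewrite /rV; field; nonzero.
have hd : `|d| <= sigma^-1.
  rewrite dE rhoE normf_div (gtr0_norm rV0) ler_pM2r ?invr_gt0//.
  by rewrite ler_norml; apply/andP; split; lra.
have he : `|e| <= sigma^-1.
  rewrite eE rhoE normf_div (gtr0_norm rV0) ler_pM2r ?invr_gt0//.
  by rewrite ler_norml; apply/andP; split; lra.
have as1 : 0 <= a <= s m.+1 by apply/andP; split; lra.
have := heat_step (x - z m k) s0 as1 p0 q0 pq1 pdqe hd he.
rewrite -sE.
have -> : x - z m k - d = x - z m.+1 k by rewrite /d; ring.
have -> : x - z m k - e = x - z m.+1 k.+1 by rewrite /e; ring.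
move/le_trans; apply; rewrite /h addrAC.
have sqs : eps <= Num.sqrt (s m.+1).
  by rewrite -[eps]ger0_norm ?(ltW eps0)// -sqrtr_sqr ler_sqrt// ltW.
have isq : (Num.sqrt (s m.+1))^-1 <= eps^-1.
  by rewrite lef_pV2 ?posrE// sqrtr_gt0.
have is1 : (s m.+1)^-1 <= (eps ^+ 2)^-1 by rewrite lef_pV2 ?posrE.
apply: lerD; [apply: lerD|].
- rewrite ler_pM2l// lerXn2r ?nnegrE ?divr_ge0 ?sqrtr_ge0 ?invr_ge0 ?(ltW sigma0) ?(ltW eps0)//.
  by rewrite ler_wpM2l// invr_ge0 ltW.
- have /andP[a0 ar] := a_rho.
  have as0 : 0 <= a / s m.+1 by rewrite divr_ge0// ltW.
  have h1 : a / s m.+1 <= sigma^-1 ^+ 2 / eps ^+ 2.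
    by apply: ler_pM => //; rewrite invr_ge0 ltW.
  by rewrite ler_pM2l// lerXn2r ?nnegrE//; apply: le_trans h1.
- apply: ler_pM; rewrite ?invr_ge0 ?(ltW s0)//.
  (* The leading terms [m.+2%:R ^+ 2 / 4] of the conditional variance and of [a] cancel; what
     remains is of the order of the variance of the chain, so the triangle inequality is
     affordable. *)
  rewrite (_ : _ - a = (m.+2%:R / 12 - (k%:R - m%:R / 2) ^+ 2) / rV ^+ 2); last first.
    by rewrite dE eE /p /q /a -!natr1; field; nonzero.
  rewrite normf_div (ger0_norm (sqr_ge0 rV)) ler_wpM2r ?invr_ge0 ?sqr_ge0//.
  apply: le_trans (ler_normB _ _) _.
  by rewrite !ger0_norm ?sqr_ge0// divr_ge0.
Qed.

Let lindeberg_sum m : (m <= N)%N ->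
  `|exc_mean m.+1 (test m) - exc_mean 1 (test 0)| <= m%:R * err.
Proof.
elim: m => [|m IHm] mN; first by rewrite subrr normr0 mul0r.
have := lindeberg_step mN; have := IHm (ltnW mN).
rewrite -natr1 mulrDl mul1r => h1 h2.
apply: le_trans (ler_distD (exc_mean m.+1 (test m)) _ _) _.
by rewrite addrC; apply: lerD.
Qed.

(** Since [N] is at most [12 * sigma ^+ 2], the three terms contribute 24, 2 and 396 times
    [sigma^-1], all powers of [eps^-1] being rounded up to the fourth. *)
Let err_le : N%:R * err <= 422 / sigma / eps ^+ 4.
Proof.
have N0 := ler0n R N; have N1 : N.+1%:R = N%:R + 1 :> R by rewrite natr1.
have N2 : N.+2%:R = N%:R + 2 :> R by rewrite -[N.+2]addn2 natrD.
have Ns : N%:R + 2 = 12 * sigma ^+ 2 by rewrite sigma2 N2; field.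
rewrite /err N1.
set i := sigma^-1; set E := eps^-1.
have i0 : 0 < i by rewrite invr_gt0.
have i1 : i <= 1 by apply: le_trans eps1.
have E1 : 1 <= E by rewrite /E invf_ge1.
have si : sigma ^+ 2 * i ^+ 2 = 1 by rewrite /i exprVn divff// expf_neq0// gt_eqF.
have E3 : E ^+ 3 <= E ^+ 4 by rewrite ler_weXn2l.
have E2 : E ^+ 2 <= E ^+ 4 by rewrite ler_weXn2l.
have E40 : 0 <= E ^+ 4 by rewrite exprn_ge0// (le_trans ler01).
have -> : 422 / sigma / eps ^+ 4 =
    24 * (i * E ^+ 4) + (2 * (i * E ^+ 4) + 396 * (i * E ^+ 4)).
  by rewrite /E exprVn -/i; ring.
rewrite 2!mulrDr -addrA; apply: lerD; [|apply: lerD].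
- apply: (@le_trans _ _ (12 * sigma ^+ 2 * (2 * (i * E) ^+ 3))).
    rewrite ler_wpM2r//; last by rewrite -Ns; lra.
    by rewrite mulr_ge0// exprn_ge0// mulr_ge0 ?(ltW i0)// (le_trans ler01).
  rewrite (_ : _ * _ = 24 * (sigma ^+ 2 * i ^+ 2) * (i * E ^+ 3)); last by ring.
  by rewrite si mulr1 ler_pM2l// ler_pM2l.
- have -> : N%:R * (2 / ((N%:R + 1) ^+ 2 * eps ^+ 2)) =
     2 * (N%:R / (N%:R + 1) ^+ 2 * E ^+ 2) by rewrite /E; field; nonzero.
  have F1 : 0 <= N%:R / (N%:R + 1) ^+ 2 :> R by rewrite divr_ge0 ?sqr_ge0.
  rewrite ler_pM2l//; apply: ler_pM F1 (sqr_ge0 _) _ E2.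
  apply: (@le_trans _ _ (i ^+ 2)); last by rewrite expr2 ler_piMr// ltW.
  have F2 : 0 < (N%:R + 1) ^+ 2 :> R by rewrite natr1 exprn_gt0.
  rewrite ler_pdivrMr//.
  have i2 : i ^+ 2 * (N%:R + 2) = 12 by rewrite Ns mulrCA mulrC [X in X * _]mulrC si mul1r.
  by have := sqr_ge0 i; nra.
- apply: (@le_trans _ _ (12 * sigma ^+ 2 * (33 * (i ^+ 2 * E ^+ 2) ^+ 2))).
    rewrite -[(eps ^+ 2)^-1]exprVn ler_wpM2r//; last by rewrite -Ns; lra.
    by rewrite mulr_ge0// sqr_ge0.
  rewrite (_ : _ * _ = 396 * (sigma ^+ 2 * i ^+ 2) * (i ^+ 2 * E ^+ 4)); last by ring.
  rewrite si mulr1; apply: (ler_wpM2l (ler0n R 396)); apply: ler_wpM2r => //.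
  by rewrite expr2 ler_piMr// ltW.
Qed.

Lemma lindeberg_smooth :
  `|exc_mean N.+1 (fun k => Phi ((x - (k%:R - N%:R / 2) / sigma) / eps)) - Phi x|
    <= 422 / sigma / eps ^+ 4 + 2 * eps ^+ 2.
Proof.
have N0 := ler0n R N.
have sN : s N = eps ^+ 2.
  by rewrite /s /v -rV2 divff ?addrK// expf_neq0// gt_eqF.
have -> : exc_mean N.+1 (fun k => Phi ((x - (k%:R - N%:R / 2) / sigma) / eps)) =
    exc_mean N.+1 (test N).
  apply: eq_exc_mean => k; rewrite /test sN sqrtr_sqr ger0_norm ?(ltW eps0)//.
  congr (Phi ((_ - _) / _)); rewrite /z /rV -natr1; field; nonzero.
(* The swaps lead back to one letter, where the test value is [Phi (x / Num.sqrt (s 0))]; as [s 0]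
   is within [eps ^+ 2] of 1, it is close to [Phi x]. *)
apply: le_trans (ler_distD (exc_mean 1 (test 0)) _ _) _; apply: lerD.
  exact: le_trans (lindeberg_sum (leqnn N)) err_le.
rewrite /exc_mean exc_tot1 divr1 /test.
have -> : z 0 0 = 0 by rewrite /z !mul0r subrr mulr0 mul0r.
rewrite subr0 mulrC; set r := (Num.sqrt (s 0))^-1.
have s01 : 1 <= s 0 <= 1 + eps ^+ 2.
  have : 0 <= v 0 / rV ^+ 2 <= eps ^+ 2.
    rewrite divr_ge0 ?sqr_ge0//=; last by rewrite /v.
    apply: (@le_trans _ _ (sigma^-1 ^+ 2)); last first.
      by rewrite lerXn2r ?nnegrE ?invr_ge0 ?(ltW sigma0) ?(ltW eps0).
    rewrite ler_pdivrMr ?exprn_gt0// /rV exprMn mulrCA -exprMn mulVf ?gt_eqF//.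
    by rewrite expr1n mulr1 /v -natr1; nra.
  by rewrite /s; lra.
have s0 : 0 < s 0 by lra.
have r0 : 0 < r by rewrite invr_gt0 sqrtr_gt0.
have rs : r ^+ 2 * s 0 = 1 by rewrite /r exprVn sqr_sqrtr ?(ltW s0)// mulVf ?gt_eqF.
have e21 : eps ^+ 2 <= 1 by rewrite exprn_ile1// ltW.
move: s01 => /andP[s1 s2].
have u0 : 0 <= r ^+ 2 * (s 0 - 1) by rewrite mulr_ge0 ?sqr_ge0 ?subr_ge0.
have v0 : 0 <= r ^+ 2 * (2 - s 0) by rewrite mulr_ge0 ?sqr_ge0 ?subr_ge0//; lra.
have w0 : 0 <= r ^+ 2 * (1 + eps ^+ 2 - s 0) by rewrite mulr_ge0 ?sqr_ge0 ?subr_ge0.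
have r1 : r <= 1 by rewrite leNgt; apply/negP => h; nra.
have r2 : 1 / 2 <= r by rewrite leNgt; apply/negP => h; nra.
apply: le_trans (Phi_scale_lipschitz x r2) _.
rewrite ler_pM2l// distrC ger0_norm ?subr_ge0//.
have : 0 <= (1 - r ^+ 2) * eps ^+ 2 by rewrite mulr_ge0 ?sqr_ge0// subr_ge0 exprn_ile1// ltW.
move: (eps ^+ 2) w0 => y; nra.
Qed.

End Lindeberg.

(** * From smooth test functions to the distribution function *)

Section CLT.
Variable R : realType.

(** The indicator is squeezed between smoothed ones shifted by [M * eps]. Beyond the shift, their
    deviation from it is a normal tail, at most [eta]; undoing the shift costs [M * eps] since [Phi]
    is 1-Lipschitz. *)
Lemma exc_cdf_le N (eps x M eta : R) : let sigma := Num.sqrt (N.+2%:R / 12) in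
  0 < eps -> eps <= 1 -> sigma^-1 <= eps -> 0 <= M ->
  Phi (- M) <= eta -> 1 - Phi M <= eta ->
  `|exc_mean N.+1 (fun k => (k%:R <= x * sigma + N%:R / 2)%R%:R) - Phi x| <=
    422 / sigma / eps ^+ 4 + 2 * eps ^+ 2 + M * eps + eta.
Proof.
move=> sigma e0 e1 se M0 tl tr.
have s0 : 0 < sigma by rewrite sqrtr_gt0 divr_gt0.
pose w k : R := (k%:R - N%:R / 2) / sigma.
pose I k : R := (k%:R <= x * sigma + N%:R / 2)%R%:R.
have IE k : I k = (w k <= x)%R%:R.
  by rewrite /I /w ler_pdivrMr// lerBlDr.
pose d := M * eps.
have up : exc_mean N.+1 I <= exc_mean N.+1 (fun k => Phi ((x + d - w k) / eps) + eta).
  apply: exc_mean_le => k _; rewrite IE; case: (lerP (w k) x) => wx /=; last first.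
    rewrite addr_ge0 ?Phi_ge0//; apply: le_trans tl; exact: Phi_ge0.
  have : Phi M <= Phi ((x + d - w k) / eps).
    by apply: Phi_nondecreasing; rewrite ler_pdivlMr// -/d; lra.
  by lra.
have lo : exc_mean N.+1 (fun k => Phi ((x - d - w k) / eps)) <=
    exc_mean N.+1 (fun k => I k + eta).
  apply: exc_mean_le => k _; rewrite IE; case: (lerP (w k) x) => wx /=.
    have := Phi_le1 ((x - d - w k) / eps); have := Phi_ge0 (- M); lra.
  have : Phi ((x - d - w k) / eps) <= Phi (- M).
    by apply: Phi_nondecreasing; rewrite ler_pdivrMr// mulNr -/d; lra.
  by lra.
rewrite exc_meanD exc_mean_cst in up; rewrite exc_meanD exc_mean_cst in lo.
have h1 : `|exc_mean N.+1 (fun k => Phi ((x + d - w k) / eps)) - Phi (x + d)| <= _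
  := lindeberg_smooth (x + d) e0 e1 se.
have h2 : `|exc_mean N.+1 (fun k => Phi ((x - d - w k) / eps)) - Phi (x - d)| <= _
  := lindeberg_smooth (x - d) e0 e1 se.
have d0 : 0 <= d by rewrite mulr_ge0// ltW.
have l1 := Phi_lipschitz x d; have l2 := Phi_lipschitz x (- d).
rewrite normrN in l2; rewrite (ger0_norm d0) in l1 l2.
rewrite -/d -/I; move: up lo h1 h2 l1 l2.
move: (exc_mean _ _) (exc_mean _ _) (exc_mean _ _) => E2 E1 E.
move: (Phi (x + d)) (Phi (x - d)) (Phi x) (_ + 2 * _) => P1 P2 P K.
rewrite !ler_norml => u l /andP[? ?] /andP[? ?] /andP[? ?] /andP[? ?].
by apply/andP; split; lra.
Qed.

Lemma cvg_inv_sigma : (Num.sqrt (n.+2%:R / 12))^-1 @[n --> \oo] --> (0 : R).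
Proof.
apply/cvgrPdist_le => e e0.
have := nbhs_infty_ger (12 / e ^+ 2); apply: filterS => n hn.
rewrite sub0r normrN ger0_norm ?invr_ge0 ?sqrtr_ge0//.
rewrite invf_ple ?posrE ?sqrtr_gt0 ?divr_gt0//.
rewrite -[e^-1]ger0_norm ?invr_ge0 ?(ltW e0)// -sqrtr_sqr ler_sqrt ?divr_ge0//.
rewrite ler_pdivlMr// mulrC exprVn; apply: le_trans hn _.
by rewrite ler_nat; lia.
Qed.

Lemma exc_clt (eta : R) : 0 < eta -> \forall n \near \oo, forall x : R,
  `|exc_mean n.+1 (fun k =>
      (k%:R <= x * Num.sqrt (n.+2%:R / 12) + n%:R / 2)%R%:R) - Phi x| <= eta.
Proof.
move=> eta0; have eta4 : 0 < eta / 4 by rewrite divr_gt0.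
have [M M0 [tl tr]] := Phi_tails eta4.
(* This makes [2 * eps ^+ 2 + M * eps] at most [eta / 4]. The width is fixed before [n] grows, and
   no choice involves [x]. *)
pose eps := Num.min 1 (eta / (4 * (M + 2))).
have e0 : 0 < eps by rewrite lt_min ltr01 divr_gt0// mulr_gt0//; lra.
have e1 : eps <= 1 by rewrite ge_min lexx.
have eM : (M + 2) * eps <= eta / 4.
  have : eps <= eta / (4 * (M + 2)) by rewrite ge_min lexx orbT.
  rewrite ler_pdivlMr; last by rewrite mulr_gt0//; lra.
  by rewrite ler_pdivlMr//; lra.
have K0 : 0 < 422 :> R by rewrite ltr0n.
move: (422 : R) K0 (@exc_cdf_le) => K K0 cdf_le.
(* Once [sigma^-1] is below [b], it is at most [eps] and the Lindeberg error is at most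
   [eta / 4]. *)
pose b := Num.min eps (eta / 4 * eps ^+ 4 / K).
have b0 : 0 < b by rewrite lt_min e0 divr_gt0// mulr_gt0// exprn_gt0.
have /cvgrPdist_le/(_ _ b0) := cvg_inv_sigma.
apply: filterS => n /=; rewrite sub0r normrN ger0_norm ?invr_ge0 ?sqrtr_ge0// le_min.
move=> /andP[se sb] x.
apply: le_trans (cdf_le _ _ x _ _ e0 e1 se (ltW M0) tl tr) _.
have h1 : K / Num.sqrt (n.+2%:R / 12) / eps ^+ 4 <= eta / 4.
  by rewrite ler_pdivrMr ?exprn_gt0//; move: sb; rewrite ler_pdivlMr//; lra.
have h2 : eps ^+ 2 <= eps by rewrite expr2 ler_piMr// ltW.
by lra.
Qed.

End CLT.

(** * Even and odd permutations *)

Section Transfer.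
Variable R : realType.
Implicit Types (b : bool) (n : nat) (f : nat -> R).

Definition AE b n : {poly R} := \sum_(s : 'S_n | odd_perm s == b) 'X^(exc s).

Let size_AE b n : (size (AE b n.+1) <= n.+1)%N.
Proof.
apply/leq_sizeP => j nj; rewrite coef_sum big1// => s _.
by rewrite coefXn gtn_eqF//; apply: leq_ltn_trans nj; exact: exc_leq.
Qed.

Let sum_coef_AE b n f :
  \sum_(k < size (AE b n.+1)) f k * (AE b n.+1)`_k =
  \sum_(s : 'S_n.+1 | odd_perm s == b) f (exc s).
Proof.
rewrite (big_ord_widen _ (fun k => f k * (AE b n.+1)`_k) (size_AE b n)).
rewrite big_mkcond/=.
under eq_bigr => k _.
  rewrite (_ : (if _ then _ else _) = f k * (AE b n.+1)`_k); last first.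
    by case: ltnP => // h; rewrite nth_default// mulr0.
  rewrite coef_sum mulr_sumr; over.
rewrite exchange_big/=; apply: eq_bigr => s _.
have h := exc_leq s; rewrite (bigD1 (Ordinal (h : exc s < n.+1)%N))//= big1 ?addr0.
  by rewrite coefXn eqxx mulr1.
move=> k ks; rewrite coefXn (_ : (k == exc s :> nat) = false) ?mulr0//.
by apply/negbTE; apply: contraNneq ks => e; apply/eqP/val_inj.
Qed.

(** The indicator of a parity class is half of 1 plus or minus the sign. *)
Let parity_sum b n f : \sum_(s : 'S_n | odd_perm s == b) f (exc s) =
  (exc_tot n f + (-1) ^+ b * exc_alt n f) / 2.
Proof.
rewrite /exc_tot /exc_alt /exc_sum mulr_sumr -big_split/= mulr_suml big_mkcond.
by apply: eq_bigr => s _; case: odd_perm; case: b => /=; field.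
Qed.

Let horner_AE b n : (AE b n.+2).[1] = n.+2`!%:R / 2.
Proof.
rewrite horner_sum; under eq_bigr do rewrite hornerXn expr1n.
have alt0 : exc_alt n.+2 (fun=> 1 : R) = 0.
  by rewrite exc_alt_diff /exc_alt /exc_sum big1// => s _; rewrite subrr mulr0.
rewrite (parity_sum b n.+2 (fun=> 1)) alt0 mulr0 addr0; congr (_ / _).
by have := exc_mean_cst n.+2 (1 : R); rewrite /exc_mean => /divr1_eq.
Qed.

(** Mean, variance and distribution function of a parity class are all instances: the value for all
    permutations plus a signed correction. *)
Let sum_pmf_AE b n f :
  \sum_(k < size (AE b n.+2)) f k * coef_pmf (AE b n.+2) k =
  exc_mean n.+2 f + (-1) ^+ b * exc_alt n.+2 f / n.+2`!%:R.
Proof.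
rewrite /coef_pmf; under eq_bigr do rewrite mulrA.
rewrite -mulr_suml sum_coef_AE parity_sum horner_AE /exc_mean.
have : n.+2`!%:R != 0 :> R by rewrite pnatr_eq0 -lt0n fact_gt0.
by move: (n.+2`!%:R) => F F0; field.
Qed.

Lemma has_coef_dist_AE b n : has_coef_dist (AE b n.+2).
Proof.
split=> [k|]; last by rewrite horner_AE divr_gt0// ltr0n fact_gt0.
by rewrite coef_sum sumr_ge0// => s _; rewrite coefXn.
Qed.

Lemma coef_mean_AE b n : coef_mean (AE b n.+3) = n.+2%:R / 2.
Proof.
rewrite /coef_mean (sum_pmf_AE b n.+1 (fun k => k%:R)).
rewrite [X in _ + _ * X / _](_ : _ = 0).
  rewrite mulr0 mul0r addr0; apply/eqP; rewrite -subr_eq0 -(exc_mean_id R n.+2).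
  by rewrite exc_meanD exc_mean_cst.
rewrite -(exc_alt_lin n 1 0); apply: eq_bigr => s _; congr (_ * _); ring.
Qed.

Lemma coef_variance_AE b n : coef_variance (AE b n.+4) = n.+4.+1%:R / 12.
Proof.
rewrite /coef_variance coef_mean_AE.
rewrite (sum_pmf_AE b n.+2 (fun k => (k%:R - n.+3%:R / 2) ^+ 2)) exc_mean_sqr.
rewrite [X in _ + _ * X / _](_ : _ = 0) ?mulr0 ?mul0r ?addr0//.
rewrite -(exc_alt_quad n 1 (- n.+3%:R) ((n.+3%:R / 2) ^+ 2)).
by apply: eq_bigr => s _; congr (_ * _); field.
Qed.

Lemma coef_cdf_AE b n (y : R) :
  coef_cdf (AE b n.+2) y = exc_mean n.+2 (fun k => (k%:R <= y)%R%:R)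
    + (-1) ^+ b * exc_alt n.+2 (fun k => (k%:R <= y)%R%:R) / n.+2`!%:R.
Proof.
rewrite -sum_pmf_AE /coef_cdf big_mkcond/=; apply: eq_bigr => k _.
by rewrite real_floor_ge_int ?num_real// -pmulrn; case: (_ <= _)%R; rewrite ?mul1r ?mul0r.
Qed.

(** The supremum is nonnegative, and eventually finite by the uniform bound, so the limit in the
    extended reals reduces to a real one. *)
Lemma asymptotically_normalP (P : nat -> {poly R}) :
  (\forall n \near \oo, has_coef_dist (P n)) ->
  (forall e : R, 0 < e -> \forall n \near \oo, forall x,
     `|coef_cdf (P n) (x * Num.sqrt (coef_variance (P n)) + coef_mean (P n))
       - Phi x| <= e) ->
  asymptotically_normal P.
Proof.
move=> hP cP; split=> //.
set S := fun n => ereal_sup _.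
have S0 n : (0 <= S n)%E.
  by apply: ereal_sup_ge; eexists; [exists 0; [|reflexivity]|rewrite lee_fin].
have Se (e : R) : 0 < e -> \forall n \near \oo, (S n <= e%:E)%E.
  move=> /cP; apply: filterS => n h; apply: ub_ereal_sup => _ [x _ <-].
  by rewrite lee_fin.
apply/fine_cvgP; split.
  have := Se 1 ltr01; apply: filterS => n h.
  by rewrite ge0_fin_numE// (le_lt_trans h)// ltry.
apply/cvgrPdist_le => e e0; have := Se _ e0; apply: filterS => n h /=.
rewrite sub0r normrN ger0_norm ?fine_ge0//.
by rewrite -lee_fin fineK// ge0_fin_numE// (le_lt_trans h)// ltry.
Qed.

Lemma asymptotically_normal_AE b : asymptotically_normal (AE b).
Proof.
apply: asymptotically_normalP.
  by exists 2%N => // -[|[|n]]//= _; exact: has_coef_dist_AE.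
move=> e e0; have e2 : 0 < e / 2 by rewrite divr_gt0.
have [N1 _ h1] := exc_clt e2.
(* The signed correction on [n] letters is at most [2 ^+ n.-1 / n!], hence below the [n]-th term of
   the exponential series at 2. *)
have /cvgrPdist_le/(_ _ e2)[N2 _ h2] := @cvg_exp_coeff R 2.
exists (N1 + N2 + 4)%N => // -[|[|[|[|n]]]]/=; rewrite ?addnS// => hn x.
rewrite coef_variance_AE (coef_mean_AE b n.+1) coef_cdf_AE.
rewrite addrAC; apply: le_trans (ler_normD _ _) _.
rewrite [leRHS](splitr e); apply: lerD.
  by apply: h1 => /=; lia.
have := h2 n.+4; rewrite /= sub0r normrN /exp_coeff/=.
move=> /(_ _)/(le_trans _); apply; last by lia.
rewrite -mulrA normrM normrX normrN1 expr1n mul1r [leLHS]normrM [leRHS]normrM ler_wpM2r//.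
apply: (@le_trans _ _ (2 ^+ n.+3 * 1)).
  by apply: exc_alt_le => k; rewrite normr_nat lern1 leq_b1.
by rewrite mulr1 ger0_norm ?exprn_ge0// ler_weXn2l// ler1n.
Qed.

End Transfer.

Theorem theorem1p3 (R : realType) :
  [/\ asymptotically_normal (AE_even R),
      asymptotically_normal (AE_odd R),
      (forall n : nat, (3 <= n)%N ->
         coef_mean (AE_even R n) = (n%:R - 1) / 2 /\
         coef_mean (AE_odd R n) = (n%:R - 1) / 2)
    & (forall n : nat, (4 <= n)%N ->
         coef_variance (AE_even R n) = (n%:R + 1) / 12 /\
         coef_variance (AE_odd R n) = (n%:R + 1) / 12)].
Proof.
have -> : AE_even R = AE R false.
  by apply/funext => n; apply: eq_bigl => s; rewrite eqbF_neg.
have -> : AE_odd R = AE R true.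
  by apply/funext => n; apply: eq_bigl => s; rewrite eqb_id.
split; [exact: asymptotically_normal_AE|exact: asymptotically_normal_AE| |].
- by case=> [|[|[|n]]]// _; rewrite !coef_mean_AE -[n.+3%:R]natr1 addrK.
- by case=> [|[|[|[|n]]]]// _; rewrite !coef_variance_AE natr1.
Qed.
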